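(* Let $k$ be a field of characteristic zero and let $A=k[x,y]/(x^a,y^b)$ with $a,b\in\{0,1,2,\dots\}\cup\{\infty\}$ (a Clements-Lindström ring of embedding dimension two). Then every homogeneous ideal $I$ of $A$ (not necessarily monomial) has the strong Lefschetz property as a graded $A$-module.
   Context: Here $x^\infty$ (resp. $y^\infty$) is interpreted as $0$, so e.g. $a=\infty$ means no power of $x$ is imposed as a relation. $A$ is standard graded. A graded $A$-module $M=\bigoplus_i M_i$ with finite-dimensional graded pieces has the strong Lefschetz property if there exists a linear form $\ell\in A_1$ such that the multiplication map $\times\ell^d\colon M_i\to M_{i+d}$ has maximal rank (is injective or surjective) for all $d>0$ and all $i$. *)

(* Defs.v *)
From HB Require Import structures.
From mathcomp Require Import all_boot all_order all_algebra.
From mathcomp Require Import mpoly.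
Set Implicit Arguments. Unset Strict Implicit. Unset Printing Implicit Defensive.
Import GRing.Theory.
Local Open Scope ring_scope.

Definition varx (k : fieldType) : {mpoly k[2]} := 'X_(0 : 'I_2).
Definition vary (k : fieldType) : {mpoly k[2]} := 'X_(1 : 'I_2).

(* Exponents a, b range over N ∪ {∞}: [Some n] is n, [None] is ∞,
   and v^∞ is interpreted as 0. *)
Definition relpow (k : fieldType) (a : option nat) (v : {mpoly k[2]}) :
  {mpoly k[2]} := if a is Some n then v ^+ n else 0.

Definition inCL (k : fieldType) (a b : option nat) (f : {mpoly k[2]}) : Prop :=
  exists g h : {mpoly k[2]},
    f = g * relpow a (varx k) + h * relpow b (vary k).

(* Homogeneous ideals of A = S/N are represented (correspondence theorem) by
   their preimages J in S: the homogeneous ideals of S containing N.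
   The image of J in A is the ideal I = J/N. *)
Definition homog_ideal_of_CL (k : fieldType) (a b : option nat)
    (J : {mpoly k[2]} -> Prop) : Prop :=
  [/\ J 0,
      (forall f g, J f -> J g -> J (f + g)),
      (forall r f, J f -> J (r * f)),
      (forall f, inCL a b f -> J f)
    & (forall f (d : nat), J f -> J (pihomog mdeg d f))].

(* The graded piece I_i of I = J/N is (J ∩ S_i) / (N ∩ S_i); its elements are
   the classes of the f with J f and f homogeneous of degree i.
   Multiplication by l^d : I_i -> I_{i+d}, [f] |-> [l^d f]. *)

Definition mul_pow_injective (k : fieldType) (a b : option nat)
    (J : {mpoly k[2]} -> Prop) (l : {mpoly k[2]}) (d i : nat) : Prop :=
  forall f, J f -> f \is i.-homog ->
    inCL a b (l ^+ d * f) -> inCL a b f.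

Definition mul_pow_surjective (k : fieldType) (a b : option nat)
    (J : {mpoly k[2]} -> Prop) (l : {mpoly k[2]}) (d i : nat) : Prop :=
  forall g, J g -> g \is (i + d)%N.-homog ->
    exists f, [/\ J f, f \is i.-homog & inCL a b (g - l ^+ d * f)].

Definition strong_Lefschetz (k : fieldType) (a b : option nat)
    (J : {mpoly k[2]} -> Prop) : Prop :=
  exists l : {mpoly k[2]}, l \is 1.-homog /\
    forall d i : nat, (0 < d)%N ->
      mul_pow_injective a b J l d i \/ mul_pow_surjective a b J l d i.

(* Main.v *)
Require Import Defs.
From HB Require Import structures.
From mathcomp Require Import all_boot all_order all_algebra.
From mathcomp Require Import mpoly ring zify.
From Stdlib Require Import Classical.
Set Implicit Arguments. Unset Strict Implicit. Unset Printing Implicit Defensive.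
Import GRing.Theory.
Local Open Scope ring_scope.

(* If a or b is infinite, then y or x is a nonzerodivisor on A. Otherwise A is
   Gorenstein with socle degree c = a + b - 2. Let W be the annihilator of I_i in
   S_(c-i) under the pairing of S_i with S_(c-i), and let l be a linear form.
   If W + l^d S_(c-i-d) = S_(c-i), then l^d is injective on I_i; if W meets
   l^d S_(c-i-d) only in 0, then l^d maps I_i onto A_(i+d). In characteristic
   zero one of the two holds when l is general: dehomogenize W to a space of
   polynomials in t, with l becoming t - p, and take p outside the zeros of the
   Wronskian of W, so that l^d imposes min(d, dim W) conditions on W. Only
   finitely many i matter, so one l serves for all i and d. *)

(** * Characteristic zero and linear algebra *)

Lemma natr_inj_pchar0 (k : fieldType) (char0 : [pchar k] =i pred0) :
  injective (fun n : nat => n%:R : k).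
Proof.
have le m n : (m <= n)%N -> m%:R = n%:R :> k -> m = n.
  move=> mn e; apply/eqP; rewrite eqn_leq mn -subn_eq0 /=.
  move/pcharf0P: char0 => /(_ (n - m)%N) <-.
  by rewrite natrB // e subrr.
by move=> m n e; case: (leqP m n) => [/le|/ltnW /le] ->.
Qed.

Lemma poly_nonroot_pchar0 (k : fieldType) (char0 : [pchar k] =i pred0)
  (p : {poly k}) : p != 0 -> exists c, p.[c] != 0.
Proof.
move=> p0; pose s := [seq n%:R : k | n <- iota 0 (size p)].
have us : uniq s by rewrite map_inj_uniq ?iota_uniq //; exact: natr_inj_pchar0.
have: ~~ all (root p) s.
  apply/negP => h; have := max_poly_roots p0 h us.
  by rewrite size_map size_iota ltnn.
by case/allPn => c _ hc; exists c.
Qed.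

(** A matrix whose rows lie in [V] is enlarged by a vector of [V] outside its row space as long as
    one exists; excluded middle decides this, and the rank can grow at most [n] times. *)
Lemma classical_rowspace (k : fieldType) n (V : 'rV[k]_n -> Prop) :
  V 0 -> (forall c u v, V u -> V v -> V (c *: u + v)) ->
  exists A : 'M[k]_n, forall v, V v <-> (v <= A)%MS.
Proof.
move=> V0 VL.
have Vsub (A : 'M[k]_n) : (forall i, V (row i A)) ->
    forall v, (v <= A)%MS -> V v.
  move=> VA v /submxP[u ->]; rewrite mulmx_sum_row.
  elim/big_rec: _ => // i w _ Vw; exact: VL.
have [r] : exists r, exists A : 'M[k]_n,
    (forall v, (v <= A)%MS -> V v) /\ (n <= r + \rank A)%N.
  by exists n, 0; split=> [v|]; rewrite ?leq_addr // submx0 => /eqP->.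
elim: r => [|r IH] [A [VA rA]].
  exists A => v; split; last exact: VA.
  move=> _; apply: submx_full; rewrite /row_full eqn_leq rA.
  by rewrite rank_leq_col.
case: (classic (forall v, V v -> (v <= A)%MS)) => [h|].
  by exists A => v; split=> [/h|/VA].
move=> nsub; have [v h] := not_all_ex_not _ _ nsub.
have [Vv /negP nv] := imply_to_and _ _ h.
apply: IH; exists (A + v)%MS; split.
  move=> w /sub_addsmxP[[w1 w2] -> /=]; rewrite -[_ *m A]scale1r.
  apply: (VL); first by apply: VA; exact: submxMl.
  by rewrite [w2]mx11_scalar mul_scalar_mx -[_ *: _]addr0; exact: VL.
rewrite (leq_trans rA) // addSn -addnS leq_add2l.
by apply: rank_ltmx; rewrite ltmxE addsmxSl addsmx_sub submx_refl.
Qed.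

(** With [V] the row space of [A], each column of [cokermx A] annihilates [V], hence is zero. This
    is how surjectivity of multiplication will be reduced to injectivity on the dual side. *)
Lemma full_of_trivial_annihilator (k : fieldType) n (V : 'rV[k]_n -> Prop) :
  V 0 -> (forall c u v, V u -> V v -> V (c *: u + v)) ->
  (forall u : 'cV[k]_n, (forall v, V v -> v *m u = 0) -> u = 0) ->
  forall v, V v.
Proof.
move=> V0 VL ann v; have [A VA] := classical_rowspace V0 VL.
apply/VA; rewrite submxE; suff -> : cokermx A = 0 by rewrite mulmx0.
apply/matrixP => i j; rewrite mxE.
suff /matrixP/(_ i 0) : col j (cokermx A) = 0 by rewrite !mxE.
apply: ann => w /VA; rewrite submxE => /eqP e.
by rewrite colE mulmxA e mul0mx.
Qed.

(** * Euler derivatives and order of vanishing *)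

(* The Euler operator t d/dt: in contrast with d/dt, it acts diagonally on
   monomials, so that leading coefficients of a Wronskian built from it form a
   plain Vandermonde matrix. *)
Definition euler (R : nzRingType) (p : {poly R}) : {poly R} := 'X * p^`().

Section Euler.
Variable k : fieldType.
Implicit Types (p q : {poly k}) (c : k).

Lemma euler_is_linear : linear (@euler k).
Proof. by move=> c p q; rewrite /euler derivD derivZ mulrDr scalerAr. Qed.

HB.instance Definition _ :=
  GRing.isLinear.Build k {poly k} {poly k} _ (@euler k) euler_is_linear.

Lemma iter_euler_linear j : linear (iter j (@euler k)).
Proof. by elim: j => [//|j IH] c p q; rewrite !iterS IH linearP. Qed.

HB.instance Definition _ j :=
  GRing.isLinear.Build k {poly k} {poly k} _ (iter j (@euler k))
    (iter_euler_linear j).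

Lemma coef_iter_euler j p n : (iter j (@euler k) p)`_n = p`_n * n%:R ^+ j.
Proof.
elim: j => [|j IH]; first by rewrite mulr1.
rewrite iterS /euler coefXM; case: n IH => [|n] IH /=.
  by rewrite expr0n /= mulr0.
by rewrite coef_deriv IH exprSr mulrA mulr_natr.
Qed.

Lemma size_iter_euler j p : (size (iter j (@euler k) p) <= size p)%N.
Proof.
by apply/leq_sizeP => n h; rewrite coef_iter_euler nth_default ?mul0r.
Qed.

Lemma euler_XsubC_exp c m q :
  euler (('X - c%:P) ^+ m.+1 * q) =
  ('X - c%:P) ^+ m * (m.+1%:R *: ('X * q) + ('X - c%:P) * euler q).
Proof.
rewrite /euler derivM deriv_exp derivXsubC mul1r /= scaler_nat exprSr.
by rewrite -[_ ^+ m *+ _]mulr_natr -[X in _ = _ * (X + _)]mulr_natr; ring.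
Qed.

(** One Euler derivative removes at most one factor t - c. The value of [r] at [c] matters for
    [j = m], where it is m! c^m q(c). *)
Lemma iter_euler_XsubC_exp c m j q : (j <= m)%N ->
  exists2 r,
    iter j (@euler k) (('X - c%:P) ^+ m * q) = ('X - c%:P) ^+ (m - j) * r &
    r.[c] = (m ^_ j)%:R * c ^+ j * q.[c].
Proof.
elim: j => [|j IH] jm; first by exists q; rewrite ?subn0 // ffactn0 !mul1r.
have [r e ec] := IH (ltnW jm).
exists ((m - j)%:R *: ('X * r) + ('X - c%:P) * euler r).
  by rewrite iterS e -[(m - j)%N]prednK ?subn_gt0 // euler_XsubC_exp -subnS.
rewrite hornerD hornerZ !hornerM hornerX hornerXsubC subrr mul0r addr0 ec.
by rewrite ffactnSr natrM exprS; ring.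
Qed.

Lemma horner_iter_euler_dvd c m j p : ('X - c%:P) ^+ m %| p -> (j < m)%N ->
  (iter j (@euler k) p).[c] = 0.
Proof.
case/dvdpP => q -> jm; rewrite mulrC.
have [r -> _] := iter_euler_XsubC_exp c q (ltnW jm).
rewrite hornerM horner_exp hornerXsubC subrr expr0n subn_eq0 leqNgt jm.
by rewrite mul0r.
Qed.

(** If the exact order of vanishing at [c] were some n < m, the n-th Euler derivative would take the
    nonzero value n! c^n q(c). At c = 0 this fails, as t d/dt always vanishes there. *)
Lemma dvd_iter_euler (char0 : [pchar k] =i pred0) c m p : c != 0 ->
  (forall j, (j < m)%N -> (iter j (@euler k) p).[c] = 0) ->
  ('X - c%:P) ^+ m %| p.
Proof.
move=> c0 H; case: (eqVneq p 0) => [->|p0]; first exact: dvdp0.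
have [n [q]] := multiplicity_XsubC p c; rewrite p0 /= => qc e.
case: (leqP m n) => [mn|nm].
  by rewrite e dvdp_mull // dvdp_exp2l.
have [r] := iter_euler_XsubC_exp c q (leqnn n).
rewrite mulrC -e subnn mul1r => er; rewrite -er H // => /esym/eqP.
rewrite !mulf_eq0 expf_eq0 (negbTE c0) andbF orbF -rootE (negbTE qc) orbF.
by move/pcharf0P: char0 => ->; rewrite ffactnn eqn0Ngt fact_gt0.
Qed.
End Euler.

(** * Wronskians of polynomials of distinct degrees *)

Lemma coef_prod_top (R : comNzRingType) (I : finType) (F : I -> {poly R})
    (n : I -> nat) : (forall i, size (F i) <= (n i).+1)%N ->
  (\prod_i F i)`_(\sum_i n i) = \prod_i (F i)`_(n i).
Proof.
move=> sF.
suff [_ ->] : (size (\prod_i F i)%R <= (\sum_i n i).+1)%N /\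
    (\prod_i F i)`_(\sum_i n i) = \prod_i (F i)`_(n i) by [].
elim/big_rec3: _ => [|i x m p _ [sp cp]]; first by rewrite size_poly1 coef1.
split.
  rewrite (leq_trans (size_polyMleq _ _)) // -subn1 leq_subLR add1n.
  by rewrite (leq_trans (leq_add (sF i) sp)) // addSn addnS.
rewrite coefM -cp.
have lt : (n i < (n i + m).+1)%N by rewrite ltnS leq_addr.
rewrite (bigD1 (Ordinal lt)) //= addKn big1 ?addr0 // => j ne.
case: (ltngtP j (n i)) => [ji|ij|e].
- rewrite [p`_ _]nth_default ?mulr0 // (leq_trans sp) //.
  by rewrite ltn_subRL ltn_add2r.
- by rewrite [(F i)`_ _]nth_default ?mul0r // (leq_trans (sF i)).
- by case/eqP: ne; exact: val_inj.
Qed.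

Definition wronskian (k : fieldType) (s : seq {poly k}) : {poly k} :=
  \det (\matrix_(i < size s, j < size s) iter j (@euler k) s`_i).

(** The coefficient in degree the sum of all n_i = deg s_i is computed row by row: entry (i, j)
    contributes lead(s_i) n_i^j. This gives a Vandermonde determinant in the n_i, which stay
    distinct in characteristic zero. *)
Lemma wronskian_neq0 (k : fieldType) (char0 : [pchar k] =i pred0)
    (s : seq {poly k}) :
  0 \notin s -> uniq [seq size p | p : {poly k} <- s] -> wronskian s != 0.
Proof.
move=> s0 us; set r := size s.
pose n (i : 'I_r) := (size s`_i).-1.
have ne0 (i : 'I_r) : s`_i != 0.
  by apply: contraNneq s0 => <-; exact: mem_nth.
have ninj : injective n.
  move=> i j e; apply/val_inj/eqP.
  rewrite -(nth_uniq 0%N _ _ us) ?size_map //= !(nth_map 0) //.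
  rewrite -[size s`_i]prednK ?lt0n ?size_poly_eq0 // -/(n i) e.
  by rewrite prednK ?lt0n ?size_poly_eq0.
suff: (wronskian s)`_(\sum_i n i) != 0 by apply: contraNneq => ->; rewrite coef0.
pose a := \row_i (n i)%:R : 'rV[k]_r.
suff -> : (wronskian s)`_(\sum_i n i) =
    (\prod_i lead_coef s`_(i : 'I_r)) * \det (Vandermonde r a).
  rewrite mulf_neq0 //; first by apply/prodf_neq0 => i _; rewrite lead_coef_eq0.
  rewrite det_Vandermonde; apply/prodf_neq0 => i _; apply/prodf_neq0 => j ij.
  rewrite !mxE subr_eq0; apply: contraTneq ij => /(natr_inj_pchar0 char0)/ninj->.
  by rewrite ltnn.
rewrite -[\det (Vandermonde _ _)]det_tr /wronskian /determinant coef_sum mulr_sumr.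
apply: eq_bigr => /= sg _; rewrite -(rmorph_sign polyC) coefCM mulrCA.
congr (_ * _).
under eq_bigr do rewrite mxE.
rewrite coef_prod_top -?big_split /=.
  by apply: eq_bigr => i _; rewrite !mxE coef_iter_euler.
by move=> i; rewrite (leq_trans (size_iter_euler _ _)) // leqSpred.
Qed.

(** * General points of a space of polynomials *)

(** Gaussian elimination on leading terms: each size contributes at most one basis element, which
    clears the top coefficient of the others. Distinct sizes are what the Wronskian argument
    needs. *)
Lemma echelon_basis (k : fieldType) (W : {poly k} -> Prop) n :
  (forall c p q, W p -> W q -> W (c *: p + q)) ->
  exists s : seq {poly k}, [/\ forall p, p \in s -> W p, 0 \notin s,
    uniq [seq size p | p : {poly k} <- s], forall p, p \in s -> (size p <= n)%N
    & forall p, W p -> (size p <= n)%N ->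
       exists a : nat -> k, p = \sum_(i < size s) a i *: s`_i].
Proof.
move=> WL; elim: n => [|n [s [Ws s0 us ss sp]]].
  exists [::]; split=> // p _; rewrite leqn0 size_poly_eq0 => /eqP->.
  by exists (fun=> 0); rewrite big_ord0.
case: (classic (exists2 q, W q & size q = n.+1)) => [[q Wq sq]|no]; last first.
  exists s; split=> // [p /ss /leqW //|p Wp]; rewrite leq_eqVlt => /orP[/eqP e|].
    by case: no; exists p.
  by rewrite ltnS; exact: sp.
have q0 : q != 0 by rewrite -size_poly_eq0 sq.
exists (q :: s); split=> [p|||p|p Wp sz].
- by rewrite inE => /predU1P[->//|/Ws].
- by rewrite inE negb_or eq_sym q0.
- rewrite /= us andbT sq; apply/negP => /mapP[p /ss + e].
  by rewrite -e ltnn.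
- by rewrite inE => /predU1P[->|/ss /leqW //]; rewrite sq.
pose c := p`_n / lead_coef q.
have [||a ea] := sp (- c *: q + p).
- exact: WL.
- apply/leq_sizeP => j; rewrite leq_eqVlt => /predU1P[<-|nj].
    rewrite coefD coefZ /c lead_coefE sq /= mulNr divfK ?addNr //.
    by move: q0; rewrite -lead_coef_eq0 lead_coefE sq.
  by rewrite coefD coefZ !nth_default ?mulr0 ?addr0 // ?sq // (leq_trans sz).
exists (fun i => if i is j.+1 then a j else c).
by rewrite /= big_ord_recl /= -ea scaleNr addNKr.
Qed.

(* In characteristic zero the vanishing sequence of a space W of polynomials at
   a general point is 0, 1, ..., dim W - 1. *)
Lemma general_point (k : fieldType) (char0 : [pchar k] =i pred0)
    (W : {poly k} -> Prop) n :
  W 0 -> (forall c p q, W p -> W q -> W (c *: p + q)) ->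
  exists2 D : {poly k}, D != 0 & forall c, c != 0 -> D.[c] != 0 -> forall d,
    (forall q, W q -> (size q <= n)%N -> ('X - c%:P) ^+ d %| q -> q = 0) \/
    (forall q, exists w, [/\ W w, (size w <= n)%N & ('X - c%:P) ^+ d %| q - w]).
Proof.
move=> W0 WL; have [s [Ws s0 us ss sp]] := echelon_basis n WL.
exists (wronskian s); first exact: wronskian_neq0.
move=> c c0 Dc d; set r := size s.
pose M : 'M[k]_r := \matrix_(i, j) (iter j (@euler k) s`_i).[c].
(* Since [M] is invertible, the Euler derivatives of order below [r] at [c] are coordinates on the
   span of [s]. *)
have uM : M \in unitmx.
  rewrite unitmxE unitfE; move: Dc; rewrite /wronskian.
  rewrite -[_.[c]]/(horner_eval c _) -det_map_mx.
  by congr (\det _ != 0); apply/matrixP => i j; rewrite !mxE.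
have evM (a : nat -> k) (j : 'I_r) :
    (iter j (@euler k) (\sum_(i < r) a i *: s`_i)).[c] =
    ((\row_(i < r) a i) *m M) 0 j.
  rewrite linear_sum horner_sum mxE; apply: eq_bigr => i _.
  by rewrite linearZ hornerZ !mxE.
case: (leqP r d) => rd; [left => q Wq sq dq | right => q].
  have [a ea] := sp q Wq sq.
  suff /rowP a0 : (\row_(i < r) a i) = 0.
    by rewrite ea big1 // => i _; have := a0 i; rewrite !mxE => ->; rewrite scale0r.
  rewrite -[LHS](mulmxK uM) (_ : _ *m M = 0) ?mul0mx //.
  apply/rowP => j; rewrite -evM -ea mxE.
  by apply: horner_iter_euler_dvd dq _; exact: leq_trans rd.
(* Interpolation: solve for the [w] with the same first [r] Euler derivatives at [c] as [q]; the two
   then agree to order [r], which exceeds [d]. *)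
pose b := \row_(j < r) (iter j (@euler k) q).[c].
pose a i := if insub i is Some o then (b *m invmx M) 0 o else 0.
have ea : \row_(i < r) a i = b *m invmx M.
  by apply/rowP => i; rewrite mxE /a insubT //= => h; congr (_ _ _); exact: val_inj.
exists (\sum_(i < r) a i *: s`_i); split.
- elim/big_rec: _ => // i p _ Wp; apply: WL => //; exact/Ws/mem_nth.
- apply: (big_ind (fun p : {poly k} => size p <= n)%N) => [|p p' hp hp'|i _].
  + by rewrite size_poly0.
  + by rewrite (leq_trans (size_polyD _ _)) // geq_max hp.
  + by rewrite (leq_trans (size_scale_leq _ _)) //; exact/ss/mem_nth.
apply: dvdp_trans (dvdp_exp2l _ (ltnW rd)) _.
apply: dvd_iter_euler => // j jr; rewrite linearB hornerD hornerN.
by rewrite (evM a (Ordinal jr)) ea mulmxKV // mxE subrr.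
Qed.

Lemma common_general_point (k : fieldType) (char0 : [pchar k] =i pred0)
    (W : nat -> {poly k} -> Prop) (n : nat -> nat) m :
  (forall i, W i 0) ->
  (forall i c p q, W i p -> W i q -> W i (c *: p + q)) ->
  exists c, forall i d, (i < m)%N ->
    (forall q, W i q -> (size q <= n i)%N -> ('X - c%:P) ^+ d %| q -> q = 0) \/
    (forall q, exists w,
       [/\ W i w, (size w <= n i)%N & ('X - c%:P) ^+ d %| q - w]).
Proof.
move=> W0 WL.
suff [D D0 HD] : exists2 D : {poly k}, D != 0 &
    forall c, c != 0 -> D.[c] != 0 -> forall i d, (i < m)%N ->
    (forall q, W i q -> (size q <= n i)%N -> ('X - c%:P) ^+ d %| q -> q = 0) \/
    (forall q, exists w,
       [/\ W i w, (size w <= n i)%N & ('X - c%:P) ^+ d %| q - w]).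
  (* The factor ['X] forces c to be nonzero. *)
  have [|c] := @poly_nonroot_pchar0 k char0 ('X * D).
    by rewrite mulf_neq0 // polyX_eq0.
  by rewrite hornerM hornerX mulf_eq0 negb_or => /andP[c0 Dc]; exists c; exact: HD.
elim: m => [|m [D D0 HD]]; first by exists 1; rewrite ?oner_eq0.
have [E E0 HE] := general_point char0 (n m) (W0 m) (WL m).
exists (D * E); first exact: mulf_neq0.
move=> c c0; rewrite hornerM mulf_eq0 negb_or => /andP[Dc Ec] i d.
rewrite ltnS leq_eqVlt => /predU1P[->|]; first exact: HE.
exact: HD.
Qed.


(** * Monomials, dehomogenization and the socle pairing *)

(** The monomials x^i y^j with [below a i] and [below b j] give a basis of A. *)
Definition below (e : option nat) (j : nat) : bool :=
  if e is Some n then (j < n)%N else true.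

Section Bivariate.
Variable k : fieldType.
Implicit Types (f g h : {mpoly k[2]}) (m : 'X_{1.. 2}).

Lemma mdeg2 m : mdeg m = (m 0%R + m 1%R)%N.
Proof.
by rewrite mdegE big_ord_recl big_ord1; congr (_ + m _)%N; exact: val_inj.
Qed.

Lemma mcoeffM_relpow0 a g (i : 'I_2) m :
  below a (m i) -> (g * relpow a 'X_i)@_m = 0.
Proof.
case: a => [n|_] /=; last by rewrite mulr0 mcoeff0.
move=> mn; rewrite mpolyXn mcoeffM big1 // => -[k1 k2] /= /eqP e.
rewrite mcoeffX; case: eqP => [e2|_]; last by rewrite mulr0.
have /(congr1 (fun m' : 'X_{1.. 2} => m' i)) := e.
rewrite -e2 mnmDE mulmnE mnm1E eqxx mul1n => e1.
by rewrite e1 ltnNge leq_addl in mn.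
Qed.

Lemma inCL0 a b : inCL a b (0 : {mpoly k[2]}).
Proof. by exists 0, 0; rewrite !mul0r addr0. Qed.

Lemma inCLD a b f g : inCL a b f -> inCL a b g -> inCL a b (f + g).
Proof.
move=> [f1 [f2 ->]] [g1 [g2 ->]]; exists (f1 + g1), (f2 + g2).
by rewrite !mulrDl addrACA.
Qed.

Lemma mpolyX_divU m (i : 'I_2) n : (n <= m i)%N ->
  'X_[m] = 'X_[m - U_(i) *+ n] * 'X_i ^+ n :> {mpoly k[2]}.
Proof.
move=> nm; rewrite mpolyXn -mpolyXD submK //; apply/mnm_lepP => j.
by rewrite mulmnE mnm1E; case: eqP => [<-|]; rewrite ?mul1n.
Qed.

Lemma inCL_mcoeffP a b f :
  inCL a b f <-> forall m, below a (m 0) -> below b (m 1) -> f@_m = 0.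
Proof.
split=> [[g [h ->]] m ma mb|H].
  by rewrite mcoeffD !mcoeffM_relpow0 ?addr0.
rewrite [f]mpolyE big_seq_cond; elim/big_rec: _ => [|m g]; first exact: inCL0.
rewrite andbT mcoeff_msupp => fm; apply: inCLD.
have [/(H m) Hm|] := boolP (below a (m 0)).
  case: b H Hm => [b|] H Hm; last by rewrite Hm ?eqxx in fm.
  case: (ltnP (m 1) b) => [/Hm e|bm]; first by rewrite e eqxx in fm.
  exists 0, (f@_m *: 'X_[m - U_(1) *+ b]).
  by rewrite mul0r add0r (mpolyX_divU bm) scalerAl.
case: a H => [a|//] H; rewrite -leqNgt => am.
exists (f@_m *: 'X_[m - U_(0) *+ a]), 0.
by rewrite mul0r addr0 (mpolyX_divU am) scalerAl.
Qed.

Lemma inCL_top a b f n : f \is n.-homog -> (a + b < n)%N ->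
  inCL (Some a.+1) (Some b.+1) f.
Proof.
move=> hf lt; apply/inCL_mcoeffP => m /= ma mb.
by apply: (dhomog_nemf_coeff hf); rewrite /= mdeg2; lia.
Qed.

(* x |-> 1, y |-> t *)
Definition dehom : {mpoly k[2]} -> {poly k} :=
  mmap (@polyC k) (fun i : 'I_2 => if i == 0 then 1 else 'X).

HB.instance Definition _ := GRing.RMorphism.on dehom.

Lemma dehom_varx : dehom (varx k) = 1.
Proof. by rewrite /dehom mmapX mmap1U. Qed.

Lemma dehom_vary : dehom (vary k) = 'X.
Proof. by rewrite /dehom mmapX mmap1U. Qed.

Lemma dehomZ c f : dehom (c *: f) = c *: dehom f.
Proof. by rewrite /dehom mmapZ mul_polyC. Qed.

Lemma coef_dehom_sum f j :
  (dehom f)`_j = \sum_(m <- msupp f) f@_m * (j == m 1)%:R.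
Proof.
rewrite /dehom /mmap coef_sum; apply: eq_bigr => m _.
rewrite coefCM /mmap1 big_ord_recl big_ord1 /= expr1n mul1r coefXn.
by congr (_ * (_ == m _)%:R); exact: val_inj.
Qed.

(** In a fixed degree the exponent of y determines the monomial, so dehomogenizing a form loses
    nothing. *)
Lemma coef_dehom f n m : f \is n.-homog -> mdeg m = n ->
  (dehom f)`_(m 1) = f@_m.
Proof.
move=> /dhomogP hf dm; rewrite coef_dehom_sum.
have eqm m' : m' \in msupp f -> (m 1%R == m' 1%R)%N = (m' == m).
  move=> /hf /=; rewrite -dm !mdeg2 => e; apply/eqP/eqP => [e1|-> //].
  apply/mnmP => i; have [->|->] : i = 0 \/ i = 1; last by [].
  - by case: i => -[|[|//]] ?; [left|right]; exact: val_inj.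
  - lia.
rewrite big_seq_cond (eq_bigr (fun m' => if m' == m then f@_m else 0)); last first.
  move=> m'; rewrite andbT => /eqm ->.
  by case: eqP => [->|_]; rewrite ?mulr1 ?mulr0.
rewrite -big_seq_cond -big_mkcond /=; have [mf|mf] := boolP (m \in msupp f).
  rewrite (big_rem m) //= eqxx big_seq_cond big1 ?addr0 // => m' /andP[+ /eqP e].
  by rewrite e mem_rem_uniq ?msupp_uniq // inE eqxx.
by rewrite (memN_msupp_eq0 mf) big1.
Qed.

Lemma coef_dehom_neq0 f n j : f \is n.-homog -> (dehom f)`_j != 0 ->
  exists m, [/\ f@_m != 0, mdeg m = n & m 1 = j].
Proof.
move=> /dhomogP hf; rewrite coef_dehom_sum => nz.
have [/hasP[m mf /eqP e]|no] := boolP (has (fun m => m 1 == j) (msupp f)).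
  by exists m; rewrite -mcoeff_msupp mf (hf m mf).
case/eqP: nz; rewrite big_seq_cond big1 // => m; rewrite andbT => mf.
have /negbTE := hasPn no m mf; rewrite eq_sym => ->; exact: mulr0.
Qed.

(* The perfect pairing of the Gorenstein ring S/(x^(a+1), y^(b+1)): multiply and
   read the coefficient of the socle generator x^a y^b, which is the coefficient
   of t^b after dehomogenization. *)
Lemma pairing_inCL a b f n (q : {poly k}) :
  inCL (Some a.+1) (Some b.+1) f -> f \is n.-homog -> (n <= a + b)%N ->
  (size q <= (a + b - n).+1)%N -> (dehom f * q)`_b = 0.
Proof.
move=> /inCL_mcoeffP /= nf hf nab sq; rewrite coefM big1 // => j _.
have [->|/(coef_dehom_neq0 hf)[m [fm dm mj]]] := eqVneq (dehom f)`_j 0.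
  by rewrite mul0r.
(* As j <= b and [f] lies in the ideal, the monomial found has x-exponent above a; hence b - j
   exceeds the degree allowed for [q]. *)
rewrite [q`_ _]nth_default ?mulr0 // (leq_trans sq) //.
have jb := ltn_ord j; rewrite mdeg2 mj in dm.
suff : (a < m 0%R)%N by lia.
rewrite ltnNge; apply: contra fm => ma; rewrite nf ?mj //; lia.
Qed.

(** Nondegeneracy: pairing with t^(b - m_1) reads off the coefficient of a basis monomial m, and
    this power is within range because m_0 <= a. *)
Lemma inCL_pairing a b f n : f \is n.-homog -> (n <= a + b)%N ->
  (forall j, (j <= a + b - n)%N -> (dehom f * 'X^j)`_b = 0) ->
  inCL (Some a.+1) (Some b.+1) f.
Proof.
move=> hf nab H; apply/inCL_mcoeffP => m /=; rewrite !ltnS => ma mb.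
have [dm|/(dhomog_nemf_coeff hf) //] := eqVneq (mdeg m) n.
rewrite -(coef_dehom hf dm).
have := H (b - m 1%R)%N; rewrite coefMXn ltnNge leq_subr /= subKn // => -> //.
move: dm; rewrite mdeg2; lia.
Qed.

Lemma inCL_mul_varx b d f : inCL None b (varx k ^+ d * f) -> inCL None b f.
Proof.
move=> /inCL_mcoeffP H; apply/inCL_mcoeffP => m _ mb.
rewrite -(mcoeffMX _ (U_(0%R) *+ d)%MM) mulrC -mpolyXn; apply: H => //.
by rewrite mnmDE mulmnE mnm1E /= mul0n.
Qed.

Lemma inCL_mul_vary a d f : inCL a None (vary k ^+ d * f) -> inCL a None f.
Proof.
move=> /inCL_mcoeffP H; apply/inCL_mcoeffP => m ma _.
rewrite -(mcoeffMX _ (U_(1%R) *+ d)%MM) mulrC -mpolyXn; apply: H => //.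
by rewrite mnmDE mulmnE mnm1E /= mul0n.
Qed.

End Bivariate.

(** * Both exponents finite and positive *)

Lemma strong_Lefschetz_finite (k : fieldType) (char0 : [pchar k] =i pred0)
    (a b : nat) (J : {mpoly k[2]} -> Prop) :
  J 0 -> (forall f g, J f -> J g -> J (f + g)) ->
  (forall r f, J f -> J (r * f)) ->
  strong_Lefschetz (Some a.+1) (Some b.+1) J.
Proof.
move=> J0 JD JM.
(* The annihilator of I_i, dehomogenized. The complementary degree a + b - i enters only later, as
   the size bound (a + b - i).+1. *)
pose W i (q : {poly k}) :=
  forall f, J f -> f \is i.-homog -> (dehom f * q)`_b = 0.
have [i|i c p q Wp Wq|c Hc] :=
    common_general_point char0 (W := W) (fun i => (a + b - i).+1) (a + b).+1.
- by move=> f _ _; rewrite mulr0 coef0.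
- by move=> f Jf hf; rewrite mulrDr -scalerAr coefD coefZ Wp ?Wq // mulr0 addr0.
pose l : {mpoly k[2]} := vary k - c *: varx k.
have hl : l \is 1.-homog.
  by rewrite rpredB ?rpredZ //= dhomogX /= mdeg1.
have dl d f : dehom (l ^+ d * f) = ('X - c%:P) ^+ d * dehom f.
  rewrite rmorphM rmorphXn rmorphB /= dehomZ dehom_varx dehom_vary.
  by rewrite -mul_polyC mulr1.
have hld d i f : f \is i.-homog -> l ^+ d * f \is (i + d)%N.-homog.
  move=> hf; rewrite addnC; apply: dhomogM => //.
  by have := dhomogMn d hl; rewrite mul1n.
have size_cofactor (q : {poly k}) d e :
    (size (q * ('X - c%:P) ^+ d)%R <= e)%N -> (size q <= e - d)%N.
  have [->|q0] := eqVneq q 0; first by rewrite size_poly0.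
  rewrite size_Mmonic ?monic_exp ?monicXsubC // size_exp_XsubC addnS /=; lia.
exists l; split=> // d i _.
(* Past the socle degree a + b the graded pieces of A vanish, so a zero source gives injectivity and
   a zero target surjectivity. *)
case: (leqP i (a + b)) => [iab|iab]; last first.
  by left => f _ hf _; apply: inCL_top hf _.
case: (leqP (i + d) (a + b)) => [idab|idab]; last first.
  right => g _ hg; exists 0; split=> //; first exact: dhomog0.
  by rewrite mulr0 subr0; apply: inCL_top hg _.
case: (Hc i d iab) => [Wd|Wd]; [right => g Jg hg | left => f Jf hf lf]; last first.
  apply: (inCL_pairing hf iab) => j jn.
  (* Write t^j = s (t - c)^d + w. Since [w] annihilates [f], pairing [f] with t^j amounts to pairing
     l^d f with [s], which gives zero. *)
  have [w [Ww sw /dvdpP[s es]]] := Wd 'X^j.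
  rewrite -['X^j](subrK w) es mulrDr coefD (Ww f) // addr0.
  rewrite [dehom f * _]mulrC -mulrA -dl mulrC.
  apply: (pairing_inCL lf (hld d _ _ hf) idab).
  rewrite (leq_trans (size_cofactor s d (a + b - i).+1 _)) //; last lia.
  rewrite -es (leq_trans (size_polyD _ _)) // geq_max size_polyN sw andbT.
  by rewrite size_polyXn.
set e := (a + b - (i + d))%N.
(* [vec] lists the pairings of a form of degree i + d with the monomials of complementary degree
   [e]; [V] below is the image of l^d on I_i in these coordinates. *)
pose vec f : 'rV[k]_e.+1 := \row_j (dehom f * 'X^j)`_b.
have vecP c' f f' : vec (c' *: f + f') = c' *: vec f + vec f'.
  apply/rowP => j; rewrite !mxE rmorphD /= dehomZ mulrDl -scalerAl.
  by rewrite coefD coefZ.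
pose V v := exists f, [/\ J f, f \is i.-homog & v = vec (l ^+ d * f)].
have [|c' u v [f [Jf hf ->]] [f' [Jf' hf' ->]]|u uV|f [Jf hf ef]] :=
    full_of_trivial_annihilator (V := V) _ _ _ (vec g).
- exists 0; split; rewrite ?dhomog0 // mulr0.
  by apply/rowP => j; rewrite !mxE rmorph0 mul0r coef0.
- exists (c' *: f + f'); split.
  + by apply: JD => //; rewrite -mul_mpolyC; exact: JM.
  + by rewrite rpredD ?rpredZ.
  + by rewrite mulrDr -scalerAr vecP.
(* A functional [u] killing [V] is pairing with [q]. Moving l^d across the pairing puts (t - c)^d q
   into [W i], where only 0 is divisible by (t - c)^d. *)
- pose q := \poly_(j < e.+1) u (inord j) 0.
  have sq : (size q <= e.+1)%N by exact: size_poly.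
  suff q0 : q = 0.
    apply/colP => j; have := congr1 (fun p : {poly k} => p`_j) q0.
    by rewrite coef_poly ltn_ord inord_val coef0 mxE.
  suff : ('X - c%:P) ^+ d * q = 0.
    by move/eqP; rewrite mulf_eq0 expf_eq0 polyXsubC_eq0 andbF => /eqP.
  apply: Wd => [f Jf hf||]; last exact: dvdp_mulr.
    have /matrixP/(_ 0 0) := uV _ (ex_intro _ f (And3 Jf hf erefl)).
    rewrite !mxE mulrA [dehom f * _]mulrC -dl => uf; rewrite -[RHS]uf.
    rewrite /q poly_def mulr_sumr coef_sum; apply: eq_bigr => j _.
    by rewrite !mxE inord_val -scalerAr coefZ mulrC.
  rewrite (leq_trans (size_polyMleq _ _)) // size_exp_XsubC addSn /=.
  move: sq; rewrite /e; move: (size q) => n; lia.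
exists f; split=> //; apply: (@inCL_pairing _ a b _ (i + d)%N) => //.
  by rewrite rpredB // hld.
move=> j je; have jlt : (j < e.+1)%N by rewrite ltnS.
have /rowP/(_ (Ordinal jlt)) := ef; rewrite !mxE /= => eg.
by rewrite rmorphB mulrBl coefB /= eg subrr.
Qed.

Theorem theorem3p9 (k : fieldType) (char0 : [pchar k] =i pred0)
    (a b : option nat) (J : {mpoly k[2]} -> Prop) :
  homog_ideal_of_CL a b J -> strong_Lefschetz a b J.
Proof.
case=> J0 JD JM _ _.
have hX (i : 'I_2) : ('X_i : {mpoly k[2]}) \is 1.-homog.
  by rewrite dhomogX /= mdeg1.
(* An infinite exponent makes l = x or l = y a nonzerodivisor; a zero exponent makes the relation 1,
   so A = 0 and any l is injective. *)
case: a => [[|a]|]; last 1 first.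
- exists (varx k); split=> [|d i _]; first exact: hX.
  by left => f _ _ /inCL_mul_varx.
- exists (vary k); split=> [|d i _]; first exact: hX.
  by left => f _ _ _; apply/inCL_mcoeffP.
case: b => [[|b]|].
- exists (vary k); split=> [|d i _]; first exact: hX.
  by left => f _ _ _; apply/inCL_mcoeffP.
- exact: strong_Lefschetz_finite.
- exists (vary k); split=> [|d i _]; first exact: hX.
  by left => f _ _ /inCL_mul_vary.
Qed.
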